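(* Let $g_{std}=\omega^1\otimes\omega^1+\omega^2\otimes\omega^2+\omega^3\otimes\omega^3$ be the standard metric on $S^3(1)=SU(2)$, and consider the isometric $S^1$-action $\mathcal{I}$ on $(S^3(1),g_{std})$ whose Killing vector field is $K=F_1$. Let $m_1,m_2$ be natural numbers and $\kappa=m_1/m_2$. Then the metric transformation $\Upsilon_{1,\kappa}$ associated with $\mathcal{I}$ satisfies $$\Upsilon_{1,\kappa}(g_{std})=\frac{1}{\kappa^2+1}\,\omega^1\otimes\omega^1+\omega^2\otimes\omega^2+\omega^3\otimes\omega^3,$$ which is a Berger metric on $S^3$.
   Context: $F_1,F_2,F_3$ is a basis of left invariant vector fields on $SU(2)=S^3$, orthonormal in the standard metric on the unit sphere $S^3(1)$, with $[F_1,F_2]=2F_3$, $[F_2,F_3]=2F_1$, $[F_3,F_1]=2F_2$; $\omega^1,\omega^2,\omega^3$ is the dual coframe. Berger metrics here are left invariant metrics of the form $A\,\omega^1\otimes\omega^1+B\,(\omega^2\otimes\omega^2+\omega^3\otimes\omega^3)$, $A,B>0$. Let $S^1=\mathbb{R}/(2\pi\mathbb{Z})$ and let $S^1(r)$ be the circle of radius $r$, with coordinate $s\in[0,2\pi)$ and metric $r^2ds^2$. For an isometric action $\mathcal{I}:S^1\times M\to M$ on a Riemannian manifold $(M,g)$, its Killing vector field is $K(x)=\left.\frac{\partial}{\partial\tau}\right|_{\tau=0}\mathcal{I}(\tau,x)$. For $r>0$ and $\kappa=m_1/m_2$, consider the isometric action $\mathcal{J}(\tau,x,s)=(\mathcal{I}(m_1\tau,x),s+m_2\tau)$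 of $S^1$ on $(M\times S^1(r),\,g_{\mathrm{prod}}=g+r^2ds^2)$. The transformed metric $\Upsilon_{r,\kappa}(g)$ is the metric induced on $M$ from the quotient metric on $(M\times S^1(r))/_\kappa\mathcal{J}$ via $x\mapsto[x,0]$; that is, for $X,Y\in T_xM$, $\Upsilon_{r,\kappa}(g)(X,Y)=g_{\mathrm{prod}}(X^\top,Y^\top)$, where $X^\top$ is the component of $(X,0)\in T_{(x,0)}(M\times S^1(r))$ that is $g_{\mathrm{prod}}$-orthogonal to the $\mathcal{J}$-orbit through $(x,0)$. *)

(* Defs.v *)
From HB Require Import structures.
From mathcomp Require Import all_boot all_order all_algebra.
From mathcomp Require Import all_classical all_reals all_analysis.
From mathcomp Require Import ring.
Set Implicit Arguments.
Unset Strict Implicit.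
Unset Printing Implicit Defensive.
Import Order.TTheory GRing.Theory Num.Theory.
Import numFieldNormedType.Exports.
Local Open Scope classical_set_scope.
Local Open Scope ring_scope.

(* Manifolds are submanifolds M of a finite-dimensional normed space E, given
   as sets.  A tensor field on M is a total function of a point and of ambient
   vectors; only its values at points of M and on tangent vectors matter. *)

Section Submanifolds.
Context {R : realType}.

(* V is finite-dimensional in all uses: continuous iterated directional
   derivatives then characterize the class C^k. *)
Fixpoint Ck {V W : normedModType R} (k : nat) (U : set V) (f : V -> W) : Prop :=
  (forall x, U x -> {for x, continuous f}) /\
  if k is k'.+1 then
    forall v, (forall x, U x -> derivable f x v) /\ Ck k' U ('D_v f)
  else True.

Definition smooth_on {V W : normedModType R} (M : set V) (f : V -> W) : Prop :=
  forall x, M x -> exists (U : set V) (h : V -> W),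
    [/\ open_nbhs x U, (forall k, Ck k U h) &
        forall y, M y -> U y -> f y = h y].

Context {E : normedModType R}.
Implicit Types (M : set E) (x X Y : E) (g : E -> E -> E -> R).

Definition curve_through M x X (c : R -> E) : Prop :=
  [/\ forall t, M (c t), c 0 = x & is_derive (0 : R) (1 : R) c X].

Definition tangent M x : set E := [set X | exists c, curve_through M x X c].

Definition metric_eq M g h : Prop :=
  forall x, M x -> forall X Y, tangent M x X -> tangent M x Y ->
    g x X Y = h x X Y.

Definition inner_product_on (T : set E) (b : E -> E -> R) : Prop :=
  [/\ forall X Y, T X -> T Y -> b X Y = b Y X,
      forall a X Y Z, T X -> T Y -> T Z ->
        b (a *: X + Y) Z = a * b X Z + b Y Z
    & forall X, T X -> X != 0 -> 0 < b X X].

(* The differential of f sends the velocity of a curve c to that of f \o c. *)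
Definition preserves_metric M g (f : E -> E) : Prop :=
  forall x X Y c d, curve_through M x X c -> curve_through M x Y d ->
    g (f x) (derive1 (f \o c) 0) (derive1 (f \o d) 0) = g x X Y.

(* An action of S^1 = R / 2 pi Z is a 2 pi-periodic action of R. *)
Record isometric_circle_action M g (I : R -> E -> E) : Prop := {
  action_stable : forall t x, M x -> M (I t x) ;
  action_periodic : forall t x, M x -> I (t + 2 * pi) x = I t x ;
  action_id : forall x, M x -> I 0 x = x ;
  action_comp : forall s t x, M x -> I (s + t) x = I s (I t x) ;
  action_smooth :
    smooth_on ([set: R] `*` M) (fun p : R * E => I p.1 p.2) ;
  action_isometric : forall t, preserves_metric M g (I t) }.

Definition killing (I : R -> E -> E) x : E := derive1 (fun t => I t x) 0.

Definition tensor (a b : E -> E -> R) : E -> E -> E -> R :=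
  fun x X Y => a x X * b x Y.

End Submanifolds.

Section Transformation.
Context {R : realType}.

(* The Euclidean scalar product (the norm of 'rV[R]_n is the sup norm). *)
Definition dot {n : nat} (u v : 'rV[R]_n) : R := \sum_(i < n) u 0 i * v 0 i.

Definition plane (a b : R) : 'rV[R]_2 := \row_(i < 2) [:: a; b]`_i.

(* S^1(r) is the circle of radius r in the Euclidean plane; circle_pt r s is
   its point of coordinate s. *)
Definition circle_pt (r s : R) : 'rV[R]_2 := plane (r * cos s) (r * sin s).

Definition rot (t : R) (p : 'rV[R]_2) : 'rV[R]_2 :=
  plane (cos t * p 0 0 - sin t * p 0 1) (sin t * p 0 0 + cos t * p 0 1).

Lemma rot_circle_pt (t r s : R) : rot t (circle_pt r s) = circle_pt r (s + t).
Proof.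
apply/rowP => i; rewrite !mxE /= sinD cosD.
by case: i => -[|[|//]] ? /=; ring.
Qed.

Lemma is_derive_circle_pt (r s : R) :
  is_derive s (1 : R) (circle_pt r) (plane (- r * sin s) (r * cos s)).
Proof.
have D : derivable (circle_pt r) s (1 : R).
  apply/derivable_mxP => i [[|[|//]] ?].
  - rewrite (_ : (fun _ => _) = (fun u => r * cos u)); first by [].
    by apply/funext => u; rewrite !mxE.
  - rewrite (_ : (fun _ => _) = (fun u => r * sin u)); first by [].
    by apply/funext => u; rewrite !mxE.
apply: DeriveDef => //; rewrite derive_mx //.
apply/rowP => -[[|[|//]] ?]; rewrite !mxE /=.
- rewrite (_ : (fun _ => _) = (fun u => r * cos u)).
    by rewrite derive_val /GRing.scale /=; ring.
  by apply/funext => u; rewrite !mxE.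
- rewrite (_ : (fun _ => _) = (fun u => r * sin u)).
    by rewrite derive_val /GRing.scale /=; ring.
  by apply/funext => u; rewrite !mxE.
Qed.

(* The Euclidean metric of the plane induces r^2 ds^2 on S^1(r). *)
Lemma circle_metric (r s : R) :
  dot (derive1 (circle_pt r) s) (derive1 (circle_pt r) s) = r ^+ 2.
Proof.
rewrite derive1E (@derive_val _ _ _ _ _ _ _ (is_derive_circle_pt r s)).
rewrite /dot !big_ord_recl big_ord0 !mxE /=.
by rewrite -[RHS]mulr1 -(cos2Dsin2 s); ring.
Qed.

Section Orthogonal.
Context {V : lmodType R}.

Definition orth_comp (b : V -> V -> R) (k v : V) : V :=
  v - (b v k / b k k) *: k.

End Orthogonal.

Context {E : normedModType R}.
Implicit Types (g : E -> E -> E -> R) (I : R -> E -> E).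

Definition prod_metric g (p X Y : E * 'rV[R]_2) : R :=
  g p.1 X.1 Y.1 + dot X.2 Y.2.

Definition prod_action I (m1 m2 : nat) (t : R) (p : E * 'rV[R]_2)
  : E * 'rV[R]_2 := (I (m1%:R * t) p.1, rot (m2%:R * t) p.2).

(* The transformed metric Upsilon_(r, m1 / m2) (g) associated with I: top Z is
   the component of (Z, 0) orthogonal to the orbit of prod_action through p,
   whose tangent line at p is spanned by the Killing field K. *)
Definition upsilon I (r : R) (m1 m2 : nat) g : E -> E -> E -> R :=
  fun x X Y =>
    let p := (x, circle_pt r 0) in
    let K := killing (prod_action I m1 m2) p in
    let top (Z : E) := orth_comp (prod_metric g p) K (Z, 0) in
    prod_metric g p (top X) (top Y).

End Transformation.

Section Sphere.
Context {R : realType}.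
Implicit Types (p q X Y : 'rV[R]_4) (F : 'rV[R]_4 -> 'rV[R]_4).

(* SU(2) = S^3 is the group of unit quaternions: (a, b, c, d) stands for
   a + b i + c j + d k, i.e. for the matrix with rows (a + b i, c + d i) and
   (- c + d i, a - b i). *)
Definition quat (a b c d : R) : 'rV[R]_4 := \row_(i < 4) [:: a; b; c; d]`_i.

Definition qmul p q : 'rV[R]_4 :=
  quat (p 0 0 * q 0 0 - p 0 1 * q 0 1 - p 0 2 * q 0 2 - p 0 3 * q 0 3)
       (p 0 0 * q 0 1 + p 0 1 * q 0 0 + p 0 2 * q 0 3 - p 0 3 * q 0 2)
       (p 0 0 * q 0 2 - p 0 1 * q 0 3 + p 0 2 * q 0 0 + p 0 3 * q 0 1)
       (p 0 0 * q 0 3 + p 0 1 * q 0 2 - p 0 2 * q 0 1 + p 0 3 * q 0 0).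

Definition S3 : set 'rV[R]_4 := [set q | dot q q = 1].

(* 'D_X (qmul p) q is the differential at q of the left translation by p. *)
Definition left_invariant_field F : Prop :=
  (forall q, S3 q -> tangent S3 q (F q)) /\
  forall p q, S3 p -> S3 q -> F (qmul p q) = 'D_(F q) (qmul p) q.

(* A field on S^3 is differentiated through its extension to R^4 minus the
   origin that is constant along rays; the bracket of two fields tangent to
   S^3 does not depend on the choice of the extensions. *)
Definition radial_ext F q : 'rV[R]_4 := F ((Num.sqrt (dot q q))^-1 *: q).

Definition lie_bracket F G q : 'rV[R]_4 :=
  'D_(F q) (radial_ext G) q - 'D_(G q) (radial_ext F) q.

Record standard_frame F1 F2 F3 : Prop := {
  frame_left_invariant : [/\ left_invariant_field F1,
    left_invariant_field F2 & left_invariant_field F3] ;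
  frame_unit : forall q, S3 q -> [/\ dot (F1 q) (F1 q) = 1,
    dot (F2 q) (F2 q) = 1 & dot (F3 q) (F3 q) = 1] ;
  frame_orthogonal : forall q, S3 q -> [/\ dot (F1 q) (F2 q) = 0,
    dot (F2 q) (F3 q) = 0 & dot (F3 q) (F1 q) = 0] ;
  frame_bracket : forall q, S3 q -> [/\ lie_bracket F1 F2 q = 2 *: F3 q,
    lie_bracket F2 F3 q = 2 *: F1 q & lie_bracket F3 F1 q = 2 *: F2 q] }.

Implicit Types w : 'rV[R]_4 -> 'rV[R]_4 -> R.

Definition one_form w : Prop :=
  forall q, S3 q -> forall a X Y, tangent S3 q X -> tangent S3 q Y ->
    w q (a *: X + Y) = a * w q X + w q Y.

Record dual_coframe F1 F2 F3 w1 w2 w3 : Prop := {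
  coframe_forms : [/\ one_form w1, one_form w2 & one_form w3] ;
  coframe1 : forall q, S3 q ->
    [/\ w1 q (F1 q) = 1, w1 q (F2 q) = 0 & w1 q (F3 q) = 0] ;
  coframe2 : forall q, S3 q ->
    [/\ w2 q (F1 q) = 0, w2 q (F2 q) = 1 & w2 q (F3 q) = 0] ;
  coframe3 : forall q, S3 q ->
    [/\ w3 q (F1 q) = 0, w3 q (F2 q) = 0 & w3 q (F3 q) = 1] }.

Implicit Types g : 'rV[R]_4 -> 'rV[R]_4 -> 'rV[R]_4 -> R.

(* Smoothness of g follows from left invariance. *)
Definition left_invariant_metric g : Prop :=
  (forall q, S3 q -> inner_product_on (tangent S3 q) (g q)) /\
  forall p q X Y, S3 p -> S3 q -> tangent S3 q X -> tangent S3 q Y ->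
    g (qmul p q) ('D_X (qmul p) q) ('D_Y (qmul p) q) = g q X Y.

Definition berger_metric w1 w2 w3 g : Prop :=
  left_invariant_metric g /\
  exists A B : R, [/\ 0 < A, 0 < B & metric_eq S3 g
    (A *: tensor w1 w1 + B *: (tensor w2 w2 + tensor w3 w3))].

Definition g_std w1 w2 w3 := tensor w1 w1 + tensor w2 w2 + tensor w3 w3.

End Sphere.

(* Main.v *)
Require Import Defs.
From HB Require Import structures.
From mathcomp Require Import all_boot all_order all_algebra.
From mathcomp Require Import all_classical all_reals all_analysis.
From mathcomp Require Import ring lra.
Set Implicit Arguments.
Unset Strict Implicit.
Unset Printing Implicit Defensive.
Import Order.TTheory GRing.Theory Num.Theory.
Import numFieldNormedType.Exports.
Local Open Scope classical_set_scope.
Local Open Scope ring_scope.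

(** On the tangent space at [q] of the sphere, the metric [g_std] is the Euclidean
    scalar product: [q], [F1 q], [F2 q], [F3 q] is an orthonormal basis of R^4,
    so the [w_i] are the scalar products with the [F_i] ([coframe_dot],
    [g_std_dot]).  The Killing field of the product action at (q, (1, 0)) is
    K = (m1 F1, m2 e) with e the unit tangent vector of the circle
    ([killing_prod_action]), of squared length m1^2 + m2^2.  For any scalar
    product b, the parts of X and Y orthogonal to K have the product
    b(X, Y) - b(X, K) b(Y, K) / b(K, K); applied to (X, 0) and (Y, 0) this is
      <X, Y> - m1^2 / (m1^2 + m2^2) w1(X) w1(Y)      ([upsilon_dot]),
    and since <X, Y> is the sum of the w_i(X) w_i(Y), only the coefficient of
    w1 (x) w1 changes, into m2^2 / (m1^2 + m2^2) = 1 / (kappa^2 + 1).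

    The result is a Berger metric because this coefficient is positive, and
    because left translations by unit quaternions are linear isometries of R^4
    that carry [F1] to itself, so that the displayed formula is left invariant
    ([upsilon_left_invariant]). *)

(** * Derivatives of curves and of linear maps *)

Section Calculus.
Context {R : realType}.

Lemma is_derive_mxP {V : normedModType R} (m n : nat) (M : V -> 'M[R]_(m, n)) t v D :
  is_derive t v M D <-> forall i j, is_derive t v (fun x => M x i j) (D i j).
Proof.
split=> [[dM DM] i j|dM].
  apply: DeriveDef; first by move/derivable_mxP: dM; apply.
  by rewrite -DM (derive_mx dM) mxE.
have dM' : derivable M t v.
  by apply/derivable_mxP => i j; have [] := dM i j.
apply: DeriveDef => //; rewrite derive_mx //.
by apply/matrixP => i j; rewrite mxE; have [_ ->] := dM i j.
Qed.

Lemma is_derive_pair {V W : normedModType R} (u : R -> V) (v : R -> W) (t : R) A B :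
  is_derive t (1 : R) u A -> is_derive t (1 : R) v B ->
  is_derive t (1 : R) (fun s => (u s, v s)) (A, B).
Proof.
move=> [du <-] [dv <-].
have {}du : differentiable u t by apply/derivable1_diffP.
have {}dv : differentiable v t by apply/derivable1_diffP.
have duv := differentiable_pair du dv.
apply: DeriveDef; first exact/derivable1_diffP.
by rewrite !deriveE // diff_pair.
Qed.

(** The coordinates reduce this to the chain rule for real functions. *)
Lemma is_derive_mulr_arg {n : nat} (u : R -> 'rV[R]_n) (k t : R) D :
  is_derive (k * t) (1 : R) u D -> is_derive t (1 : R) (fun s => u (k * s)) (k *: D).
Proof.
move=> /is_derive_mxP du; apply/is_derive_mxP => i j; rewrite mxE.
have dk : is_derive t (1 : R) (fun s : R => k * s) k.
  by apply: is_derive_eq; rewrite /GRing.scale /= mulr1.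
rewrite mulrC.
exact: (@is_derive1_comp _ (fun s => u s i j) (fun s => k * s) t _ _ (du i j)).
Qed.

(** The difference quotient of a linear map is constant in the increment. *)
Lemma derive_linear_map {V W : normedModType R} (f : V -> W) x v :
  linear f -> 'D_v f x = f v.
Proof.
move=> lf; apply/cvg_lim => //.
have fE h : h != 0 -> h^-1 *: (f (h *: v + x) - f x) = f v.
  by move=> h0; rewrite lf addrK scalerA mulVf // scale1r.
apply: cvg_near_cst.
by near=> h; rewrite /= fE //; near: h; exact: nbhs_dnbhs_neq.
Unshelve. all: by end_near. Qed.

End Calculus.

(** * Euclidean scalar product *)

Section Euclid.
Context {R : realType} {n : nat}.
Implicit Types u v w : 'rV[R]_n.

Lemma dotE u v : dot u v = (u *m v^T) 0 0.
Proof. by rewrite mxE; apply: eq_bigr => i _; rewrite mxE. Qed.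

Lemma dotC u v : dot u v = dot v u.
Proof. by apply: eq_bigr => i _; rewrite mulrC. Qed.

Lemma dot_linearl a u v w : dot (a *: u + v) w = a * dot u w + dot v w.
Proof. by rewrite !dotE mulmxDl -scalemxAl [LHS]mxE [X in X + _]mxE. Qed.

Lemma dotDl u v w : dot (u + v) w = dot u w + dot v w.
Proof. by rewrite -{1}[u]scale1r dot_linearl mul1r. Qed.

Lemma dot_ge0 v : 0 <= dot v v.
Proof. by apply: sumr_ge0 => i _; rewrite -expr2 sqr_ge0. Qed.

Lemma dot0l v : dot 0 v = 0.
Proof. by rewrite dotE mul0mx mxE. Qed.

Lemma dotZl a u v : dot (a *: u) v = a * dot u v.
Proof. by rewrite -[_ *: _]addr0 dot_linearl dot0l addr0. Qed.

Lemma dotDr u v w : dot u (v + w) = dot u v + dot u w.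
Proof. by rewrite dotC dotDl !(dotC _ u). Qed.

Lemma dotZr a u v : dot u (a *: v) = a * dot u v.
Proof. by rewrite dotC dotZl dotC. Qed.

(** The matrix [M] with rows [e i] satisfies M M^T = 1; for square matrices this
    gives M^T M = 1, and v = (v M^T) M is the expansion. *)
Lemma orthonormal_expansion (e : 'I_n -> 'rV[R]_n) v :
  (forall i j, dot (e i) (e j) = (i == j)%:R) ->
  v = \sum_i dot v (e i) *: e i.
Proof.
move=> eE; pose M := \matrix_i e i.
have MM : M *m M^T = 1%:M.
  apply/matrixP => i j; rewrite !mxE -eE.
  by apply: eq_bigr => k _; rewrite !mxE.
rewrite -[LHS]mulmx1 -(mulmx1C MM) mulmxA mulmx_sum_row.
apply: eq_bigr => i _; rewrite rowK; congr (_ *: _).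
by rewrite mxE; apply: eq_bigr => k _; rewrite !mxE.
Qed.

Lemma is_derive_dot (c d : R -> 'rV[R]_n) (t : R) X Y :
  is_derive t (1 : R) c X -> is_derive t (1 : R) d Y ->
  is_derive t (1 : R) (fun s => dot (c s) (d s)) (dot X (d t) + dot (c t) Y).
Proof.
move=> /is_derive_mxP dc /is_derive_mxP dd.
rewrite (_ : (fun s => _) = \sum_(i < n) ((fun s => c s 0 i) * (fun s => d s 0 i))).
  apply: is_derive_eq; rewrite -big_split /=; apply: eq_bigr => i _.
  by rewrite /GRing.scale /= addrC (mulrC (d t 0 i)).
by apply/funext => s; rewrite fct_sumE.
Qed.

End Euclid.

(** * Tangent spaces of the sphere and quaternion translations *)

Section Sphere.
Context {R : realType}.
Implicit Types p q X Y : 'rV[R]_4.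

Lemma dot4E p q :
  dot p q = p 0 0 * q 0 0 + p 0 1 * q 0 1 + p 0 2 * q 0 2 + p 0 3 * q 0 3.
Proof.
rewrite /dot !big_ord_recl big_ord0 addr0 !addrA.
by congr (_ * _ + _ * _ + _ * _ + _ * _); congr (_ 0 _); apply/val_inj.
Qed.

(** Multiplicativity of the quaternion norm, polarized in the second factor. *)
Lemma qmul_dot p X Y : dot (qmul p X) (qmul p Y) = dot p p * dot X Y.
Proof. by rewrite !dot4E !mxE /=; ring. Qed.

Lemma qmul_linear p : linear (qmul p).
Proof.
by move=> a X Y; apply/rowP => -[[|[|[|[|//]]]] ?]; rewrite !mxE /=; ring.
Qed.

(** For a unit vector [q] orthogonal to [X], the great circle (a constant curve
    if X = 0) leaving [q] with velocity [X], in its rational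
    (stereographic) parametrization: with s = t^2 |X|^2 / 4, the squared norm of
    (1 - s) q + t X is (1 - s)^2 + 4 s = (1 + s)^2. *)
Definition stereo_curve q X (t : R) : 'rV[R]_4 :=
  let s := t ^+ 2 * dot X X / 4 in (1 + s)^-1 *: ((1 - s) *: q + t *: X).

(** Velocities are orthogonal to [q] because <c, c> is constant along a curve [c]
    of the sphere; conversely [stereo_curve] realizes every orthogonal vector. *)
Lemma tangent_S3 q X : S3 q -> tangent S3 q X <-> dot q X = 0.
Proof.
move=> qq; have qq1 : dot q q = 1 := qq; split=> [[c [Mc c0 dc]]|qX].
  have [_] := is_derive_dot dc dc.
  rewrite (_ : (fun _ => _) = cst 1); last by apply/funext => t; exact: Mc.
  rewrite derive_cst c0 (dotC X) => /eqP.
  by rewrite eq_sym -mulr2n mulrn_eq0 => /eqP.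
exists (stereo_curve q X).
have s_ge0 t : 0 <= t ^+ 2 * dot X X / 4.
  by rewrite divr_ge0 // mulr_ge0 ?sqr_ge0 ?dot_ge0.
split=> [t||].
- have := s_ge0 t; rewrite /S3 /= /stereo_curve.
  set s := _ / 4 => s0.
  have sE : t * (t * dot X X) = 4 * s by rewrite /s; field.
  have s1 : 1 + s != 0 by rewrite lt0r_neq0 // ltr_pwDl.
  rewrite dotZl dotZr dotDl !dotDr !dotZl !dotZr.
  rewrite (dotC X q) qX qq1 sE.
  by field.
- rewrite /stereo_curve.
  by rewrite expr0n /= !mul0r scale0r addr0 subr0 addr0 invr1 !scale1r.
- apply/is_derive_mxP => i j; pose k := dot X X / 4.
  rewrite (_ : (fun _ => _) =
      (fun t => (1 + k * t ^+ 2)^-1) *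
      (fun t => (1 - k * t ^+ 2) * q i j + t * X i j)); last first.
    apply/funext => t; rewrite /stereo_curve.
    by rewrite (_ : t ^+ 2 * _ / 4 = k * t ^+ 2) ?mxE ?mxE //; rewrite /k; ring.
  have d0 : is_derive (0 : R) (1 : R) (fun t => k * t ^+ 2) 0.
    apply: is_derive_eq.
    by rewrite /GRing.scale /= !mul0r addr0 mulr0.
  have d1 : is_derive (0 : R) (1 : R) (fun t => (1 + k * t ^+ 2)^-1) 0.
    have := @is_deriveV _ (fun t => 1 + k * t ^+ 2) 0 0 1.
    rewrite expr0n /= mulr0 addr0 scaler0; apply; first exact: oner_neq0.
    by apply: is_derive_eq; rewrite mulr0.
  apply: is_derive_eq.
  by rewrite /GRing.scale /= expr0n /= mulr0 addr0 invr1; ring.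
Qed.

Lemma tangent_S3_linear q a X Y : S3 q ->
  tangent S3 q X -> tangent S3 q Y -> tangent S3 q (a *: X + Y).
Proof.
move=> qq /(tangent_S3 _ qq) qX /(tangent_S3 _ qq) qY.
by apply/(tangent_S3 _ qq); rewrite dotDr dotZr qX qY mulr0 addr0.
Qed.

Lemma tangent_S3_0 q : S3 q -> tangent S3 q 0.
Proof. by move=> qq; apply/(tangent_S3 _ qq); rewrite dotC dot0l. Qed.

Lemma tangent_S3Z q a X : S3 q -> tangent S3 q X -> tangent S3 q (a *: X).
Proof.
move=> qq qX; rewrite -[_ *: _]addr0.
by apply: tangent_S3_linear => //; exact: tangent_S3_0.
Qed.

Lemma S3_qmul p q : S3 p -> S3 q -> S3 (qmul p q).
Proof. by move=> pp qq; rewrite /S3 /= qmul_dot pp qq mulr1. Qed.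

Lemma tangent_qmul p q X : S3 p -> S3 q ->
  tangent S3 q X -> tangent S3 (qmul p q) (qmul p X).
Proof.
move=> pp qq /(tangent_S3 _ qq) qX; apply/tangent_S3; first exact: S3_qmul.
by rewrite qmul_dot qX mulr0.
Qed.

End Sphere.

(** * Frame and coframe in terms of the Euclidean product *)

Section Frame.
Context {R : realType}.
Variables (F1 F2 F3 : 'rV[R]_4 -> 'rV[R]_4).
Variables (w1 w2 w3 : 'rV[R]_4 -> 'rV[R]_4 -> R).
Hypothesis frameF : standard_frame F1 F2 F3.
Implicit Types (p q X Y : 'rV[R]_4).

Lemma frame_tangent q : S3 q ->
  [/\ tangent S3 q (F1 q), tangent S3 q (F2 q) & tangent S3 q (F3 q)].
Proof.
move=> qq; have [[T1 _] [T2 _] [T3 _]] := frame_left_invariant frameF.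
by split; auto.
Qed.

(** The base point [q] completes the frame to an orthonormal basis of R^4, and
    the coefficient of a tangent vector along [q] vanishes. *)
Lemma frame_expansion q X : S3 q -> tangent S3 q X ->
  X = dot X (F1 q) *: F1 q + dot X (F2 q) *: F2 q + dot X (F3 q) *: F3 q.
Proof.
move=> qq /(tangent_S3 _ qq) qX.
have [] := frame_tangent qq.
move=> /(tangent_S3 _ qq) q1 /(tangent_S3 _ qq) q2 /(tangent_S3 _ qq) q3.
have [u1 u2 u3] := frame_unit frameF qq.
have [v12 v23 v31] := frame_orthogonal frameF qq.
pose e (i : 'I_4) : 'rV[R]_4 := [:: q; F1 q; F2 q; F3 q]`_i.
rewrite {1}(@orthonormal_expansion _ _ e X).
  by rewrite !big_ord_recl big_ord0 /e /= (dotC X q) qX scale0r add0r addr0 addrA.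
by move=> [[|[|[|[|//]]]] ?] [[|[|[|[|//]]]] ?]; rewrite /e /= // dotC.
Qed.

(** Both sides are linear on the tangent space and agree on the frame.  A one-form
    is linear on tangent vectors only, so each partial sum of the expansion has to
    be recognized as tangent. *)
Lemma coframe_dot q X : dual_coframe F1 F2 F3 w1 w2 w3 ->
  S3 q -> tangent S3 q X ->
  [/\ w1 q X = dot X (F1 q), w2 q X = dot X (F2 q) & w3 q X = dot X (F3 q)].
Proof.
move=> cow qq qX; have [l1 l2 l3] := coframe_forms cow.
have [T1 T2 T3] := frame_tangent qq.
have lin_expand w : one_form w -> w q X = dot X (F1 q) * w q (F1 q) +
    (dot X (F2 q) * w q (F2 q) + dot X (F3 q) * w q (F3 q)).
  move=> lw; have w0 : w q 0 = 0.
    have := lw q qq (-1) _ _ T1 T1.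
    by rewrite scaleN1r mulN1r !addNr.
  have wZ a Y : tangent S3 q Y -> w q (a *: Y) = a * w q Y.
    by move=> qY; rewrite -[a *: Y]addr0 lw ?w0 ?addr0 //; exact: tangent_S3_0.
  rewrite {1}(frame_expansion qq qX) -addrA lw // ?lw ?wZ //.
    exact: tangent_S3Z.
  by apply: tangent_S3_linear => //; exact: tangent_S3Z.
have [w11 w12 w13] := coframe1 cow qq.
have [w21 w22 w23] := coframe2 cow qq.
have [w31 w32 w33] := coframe3 cow qq.
rewrite !lin_expand // w11 w12 w13 w21 w22 w23 w31 w32 w33.
by rewrite !mulr0 !mulr1 !add0r !addr0.
Qed.

Lemma frame_parseval q X Y : S3 q -> tangent S3 q X -> dot X Y =
  dot X (F1 q) * dot Y (F1 q) + dot X (F2 q) * dot Y (F2 q)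
  + dot X (F3 q) * dot Y (F3 q).
Proof.
move=> qq qX; rewrite {1}(frame_expansion qq qX).
by rewrite !dotDl !dotZl !(dotC _ Y).
Qed.

Lemma g_std_dot q X Y : dual_coframe F1 F2 F3 w1 w2 w3 -> S3 q ->
  tangent S3 q X -> tangent S3 q Y -> g_std w1 w2 w3 q X Y = dot X Y.
Proof.
move=> cow qq qX qY; rewrite (frame_parseval _ qq qX).
have [<- <- <-] := coframe_dot cow qq qX.
by have [<- <- <-] := coframe_dot cow qq qY.
Qed.

End Frame.

(** * Killing field of the product action *)

Section Killing.
Context {R : realType}.

(** Makes the Killing vector an actual velocity, to which the chain rule applies.
    A smooth local extension of the action to R x E has a derivative in the
    direction (1, 0), and along that direction it follows the orbit near time 0. *)
Lemma action_orbit_derivable {E : normedModType R} (M : set E) g I q :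
  isometric_circle_action M g I -> M q ->
  derivable (fun t => I t q) (0 : R) (1 : R).
Proof.
move=> actI Mq.
have Mq' : ([set: R] `*` M) (0 : R, q) by split.
have [U [h [[Uo U0q] hC Ih]]] := action_smooth actI Mq'.
have [_ /(_ (1, 0))[dh _]] := hC 1%N.
have {}dh := dh _ U0q.
have near_orbit : \forall t \near (0 : R), U (t, q).
  have [[A B] [/= A0 Bq] sAB] := open_nbhs_nbhs (conj Uo U0q).
  near=> t; apply: sAB; split=> /=; last exact: nbhs_singleton.
  by near: t; exact: A0.
apply: (@near_eq_derivable _ _ _ (fun t : R => h (t, q))).
  by near=> t; rewrite -Ih //; near: t; exact: near_orbit.
move: dh; rewrite /derivable.
rewrite (_ : (fun s : R => s^-1 *: (h (s *: (1, 0) + (0, q)) - h (0, q))) =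
  (fun s : R => s^-1 *: (h (s *: 1 + 0, q) - h (0, q)))) //.
apply/funext => s; congr (_ *: (h _ - _)).
by apply/pair_equal_spec; rewrite /= scaler0 add0r.
Unshelve. all: by end_near. Qed.

Lemma killing_prod_action {n : nat} (I : R -> 'rV[R]_n -> 'rV[R]_n) (r : R) m1 m2 q :
  derivable (fun t => I t q) (0 : R) (1 : R) ->
  killing (prod_action I m1 m2) (q, circle_pt r 0) =
  (m1%:R *: killing I q, m2%:R *: plane 0 r).
Proof.
move=> dI; rewrite /killing !derive1E.
have [_ <-] // : is_derive (0 : R) (1 : R)
  (fun t => prod_action I m1 m2 t (q, circle_pt r 0))
  (m1%:R *: 'D_1 (I^~ q) 0, m2%:R *: plane 0 r).
apply: is_derive_pair => /=.
  have := @is_derive_mulr_arg _ _ (fun t => I t q) m1%:R 0 ('D_1 (I^~ q) 0).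
  by rewrite mulr0; apply; exact: derivableP.
under eq_fun do rewrite rot_circle_pt add0r.
apply: is_derive_mulr_arg; rewrite mulr0.
by have := is_derive_circle_pt r 0; rewrite sin0 cos0 mulr0 mulr1.
Qed.

End Killing.

(** * The transformed metric *)

Section Transform.
Context {R : realType}.
Variables (F1 F2 F3 : 'rV[R]_4 -> 'rV[R]_4).
Variables (w1 w2 w3 : 'rV[R]_4 -> 'rV[R]_4 -> R).
Hypothesis frameF : standard_frame F1 F2 F3.
Hypothesis coframew : dual_coframe F1 F2 F3 w1 w2 w3.
Variable I : R -> 'rV[R]_4 -> 'rV[R]_4.
Hypothesis actionI : isometric_circle_action S3 (g_std w1 w2 w3) I.
Hypothesis killingI : forall q, S3 q -> killing I q = F1 q.
Variables m1 m2 : nat.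
Hypothesis m2_gt0 : (0 < m2)%N.

Local Notation G := (upsilon I 1 m1 m2 (g_std w1 w2 w3)).
Local Notation N := (m1%:R ^+ 2 + m2%:R ^+ 2 : R).

Lemma orbit_sq_gt0 : 0 < N.
Proof.
by rewrite ltr_wpDl ?sqr_ge0 // exprn_even_gt0 //= pnatr_eq0 -lt0n.
Qed.

(** Removing the component along K = (m1 F1, m2 e) subtracts the rank-one form
    b(X, K) b(Y, K) / b(K, K) from the product metric b. *)
Lemma upsilon_dot q X Y : S3 q -> tangent S3 q X -> tangent S3 q Y ->
  G q X Y = dot X Y - m1%:R ^+ 2 / N * (dot X (F1 q) * dot Y (F1 q)).
Proof.
move=> qq qX qY.
have [T1 _ _] := frame_tangent frameF qq.
have [F11 _ _] := frame_unit frameF qq.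
have N0 : N != 0 by rewrite lt0r_neq0 // orbit_sq_gt0.
have ee : dot (plane 0 1) (plane 0 1) = 1 :> R.
  by rewrite /dot !big_ord_recl big_ord0 !mxE /=; ring.
pose a : R := m1%:R; pose b : R := m2%:R.
have TaF : tangent S3 q (a *: F1 q) by exact: tangent_S3Z.
have gKK : prod_metric (g_std w1 w2 w3) (q, circle_pt 1 0)
    (a *: F1 q, b *: plane 0 1) (a *: F1 q, b *: plane 0 1) = N.
  by rewrite /prod_metric /= (g_std_dot frameF) // !dotZl !dotZr F11 ee; ring.
have gZK Z : tangent S3 q Z -> prod_metric (g_std w1 w2 w3) (q, circle_pt 1 0)
    (Z, 0) (a *: F1 q, b *: plane 0 1) = a * dot Z (F1 q).
  move=> qZ.
  by rewrite /prod_metric /= (g_std_dot frameF) // dot0l dotZr addr0.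
have dI := action_orbit_derivable actionI qq.
rewrite /upsilon (killing_prod_action _ _ _ dI) killingI //.
rewrite /orth_comp gKK !gZK // /prod_metric /= !sub0r.
have Ttop Z c : tangent S3 q Z -> tangent S3 q (Z - c *: (a *: F1 q)).
  move=> qZ; rewrite addrC -scaleNr.
  exact: tangent_S3_linear.
rewrite (g_std_dot frameF) //; try exact: Ttop.
set cX := _ * dot X _ / _; set cY := _ * dot Y _ / _.
rewrite -!(scaleNr cX) -!(scaleNr cY) !(dotDl, dotDr, dotZl, dotZr).
rewrite F11 ee (dotC (F1 q) Y) /cX /cY /a /b.
by field.
Qed.

(** [qmul p] preserves the scalar product and carries [F1 q] to [F1 (qmul p q)],
    hence preserves both terms of [upsilon_dot]. *)
Lemma upsilon_left_invariant p q X Y : S3 p -> S3 q ->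
  tangent S3 q X -> tangent S3 q Y ->
  G (qmul p q) ('D_X (qmul p) q) ('D_Y (qmul p) q) = G q X Y.
Proof.
move=> pp qq qX qY.
have dqmul Z : 'D_Z (qmul p) q = qmul p Z.
  by apply: derive_linear_map; exact: qmul_linear.
have pq := S3_qmul pp qq.
have [[_ /(_ p q pp qq) F1pq] _ _] := frame_left_invariant frameF.
rewrite !dqmul !upsilon_dot //; try exact: tangent_qmul.
by rewrite F1pq dqmul !qmul_dot pp !mul1r.
Qed.

(** Since 1 - m1^2 / N = m2^2 / N, only the coefficient along [w1] changes. *)
Lemma upsilon_coframe q X Y : S3 q -> tangent S3 q X -> tangent S3 q Y ->
  G q X Y = m2%:R ^+ 2 / N * (w1 q X * w1 q Y) + w2 q X * w2 q Y
    + w3 q X * w3 q Y.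
Proof.
move=> qq qX qY; rewrite upsilon_dot // (frame_parseval frameF Y qq qX).
have [-> -> ->] := coframe_dot frameF coframew qq qX.
have [-> -> ->] := coframe_dot frameF coframew qq qY.
have N0 : N != 0 by rewrite lt0r_neq0 // orbit_sq_gt0.
by field.
Qed.

(** If all the [w_i] vanish at [X], then so does its expansion in the frame; hence
    the form of [upsilon_coframe], with positive coefficients, is definite. *)
Lemma upsilon_inner_product q : S3 q -> inner_product_on (tangent S3 q) (G q).
Proof.
move=> qq; split=> [X Y qX qY|a X Y Z qX qY qZ|X qX X0].
- by rewrite !upsilon_dot // dotC; ring.
- by rewrite !upsilon_dot ?dot_linearl //; [ring | exact: tangent_S3_linear].
- have c0 : 0 < m2%:R ^+ 2 / N :> R.
    by rewrite divr_gt0 ?orbit_sq_gt0 // exprn_gt0 // ltr0n.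
  rewrite upsilon_coframe // -!expr2.
  have : [|| 0 < w1 q X ^+ 2, 0 < w2 q X ^+ 2 | 0 < w3 q X ^+ 2].
    rewrite !exprn_even_gt0 //=; apply: contraNT X0; rewrite !negb_or !negbK => /and3P[].
    have [-> -> ->] := coframe_dot frameF coframew qq qX.
    move=> /eqP x1 /eqP x2 /eqP x3.
    by rewrite (frame_expansion frameF qq qX) x1 x2 x3 !scale0r !addr0.
  set c := _ / _; rewrite -/c in c0.
  move: (sqr_ge0 (w1 q X)) (sqr_ge0 (w2 q X)) (sqr_ge0 (w3 q X)).
  by move: (_ ^+ 2) (_ ^+ 2) (_ ^+ 2) => x y z x0 y0 z0; case/or3P; nra.
Qed.

End Transform.

Unset Implicit Arguments.

Theorem mainTheorem3 (R : realType)
    (F1 F2 F3 : 'rV[R]_4 -> 'rV[R]_4)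
    (w1 w2 w3 : 'rV[R]_4 -> 'rV[R]_4 -> R)
    (I : R -> 'rV[R]_4 -> 'rV[R]_4)
    (m1 m2 : nat) (kappa : R)
    (frameF : standard_frame F1 F2 F3)
    (coframew : dual_coframe F1 F2 F3 w1 w2 w3)
    (actionI : isometric_circle_action S3 (g_std w1 w2 w3) I)
    (killingI : forall q, S3 q -> killing I q = F1 q)
    (m2_gt0 : (0 < m2)%N)
    (kappaE : kappa = m1%:R / m2%:R) :
  metric_eq S3 (upsilon I 1 m1 m2 (g_std w1 w2 w3))
    ((1 / (kappa ^+ 2 + 1)) *: tensor w1 w1 + tensor w2 w2 + tensor w3 w3) /\
  berger_metric w1 w2 w3 (upsilon I 1 m1 m2 (g_std w1 w2 w3)).
Proof.
have b0 : m2%:R != 0 :> R by rewrite pnatr_eq0 -lt0n.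
have N0 : m1%:R ^+ 2 + m2%:R ^+ 2 != 0 :> R.
  by rewrite lt0r_neq0 // orbit_sq_gt0.
have cE : 1 / (kappa ^+ 2 + 1) = m2%:R ^+ 2 / (m1%:R ^+ 2 + m2%:R ^+ 2).
  by rewrite kappaE; field; rewrite N0.
have upsilonE : metric_eq S3 (upsilon I 1 m1 m2 (g_std w1 w2 w3))
    ((1 / (kappa ^+ 2 + 1)) *: tensor w1 w1 + tensor w2 w2 + tensor w3 w3).
  move=> q qq X Y qX qY.
  by rewrite (upsilon_coframe frameF coframew actionI killingI m1 m2_gt0 qq qX qY)
    -cE.
split; [exact: upsilonE | split; first split].
- by move=> q; exact: (upsilon_inner_product frameF coframew actionI killingI).
- move=> p q X Y.
  exact: (upsilon_left_invariant frameF coframew actionI killingI).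
- exists (1 / (kappa ^+ 2 + 1)), 1; split=> //.
    by rewrite divr_gt0 // ltr_wpDl ?sqr_ge0.
  by rewrite scale1r addrA.
Qed.
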